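(* Let $d,k\in\mathbb{N}$ with $2\le k\le d$. Then $$\mathrm{MPV}(d,k)=\max_{i=k,\ldots,d}(-1)^{d-i}\binom{d-k}{i-k}\big(\gamma_i^{(k)}\big)^{-1}.$$ Moreover, let $i_0\in\{k,\ldots,d\}$ be such that $$\mathrm{MPV}(d,k)=(-1)^{d-i_0}\binom{d-k}{i_0-k}\big(\gamma_{i_0}^{(k)}\big)^{-1}.$$ Put $$a=1-\frac{\alpha_{i_0}^{(k)}}{\gamma_{i_0}^{(k)}},\qquad \mathcal B=[a,1]^d,$$ and define $q_0,\ldots,q_d$ by $$q_i=\begin{cases}0,& i=0,\ldots,i_0-1,\\ \big(\gamma_{i_0}^{(k)}\big)^{-1},& i=i_0,\\ \sum_{j=1}^{k}\binom{k}{j}(-1)^{j+1}q_{i-j},& i=i_0+1,\ldots,d.\end{cases}$$ Then there exists a $k$-increasing $d$-variate quasi-copula $Q:[0,1]^d\to[0,1]$ such that $Q(z)=q_{d-S(z)}$ for every $z\in\{a,1\}^d$, where $S(z)$ is the number of coordinates of $z$ equal to $a$, and such that $V_Q(\mathcal B)=\mathrm{MPV}(d,k)$.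
   Context: For a $d$-box $\mathcal B=\prod_{i=1}^d[a_i,b_i]\subseteq[0,1]^d$ and a function $F$ defined on it, the $F$-volume is $V_F(\mathcal B)=\sum_{z}(-1)^{S(z)}F(z)$, the sum being over the $2^d$ vertices $z$ of $\mathcal B$ and $S(z)=\operatorname{card}\{j: z_j=a_j\}$ (degenerate boxes have volume $0$). A function of $d$ variables is $d$-increasing if $V_F(\mathcal B)\ge0$ for every $d$-box $\mathcal B$ in its domain. A $d$-variate quasi-copula ($d\ge2$) is a function $Q:[0,1]^d\to[0,1]$ such that: $Q(u)=0$ whenever some coordinate $u_i=0$; $Q(1,\ldots,1,u_i,1,\ldots,1)=u_i$ for every $i$; $Q$ is nondecreasing in each variable; and $|Q(u)-Q(v)|\le\sum_{i=1}^d|u_i-v_i|$ for all $u,v\in[0,1]^d$. For a function $F$ on a box $\mathcal B=\prod_{j=1}^d[x_j,y_j]$, a $k$-section of $F$ is the function of $k$ variables obtained by fixing the coordinates $z_j=a_j\in[x_j,y_j]$ for $j\notin A$ and letting $z_j\in[x_j,y_j]$ vary for $j\in A$, where $A\subseteq\{1,\ldots,d\}$ has $k$ elements. $F$ is $k$-increasing ($1\le k\le d$) if each of its $k$-sections is $k$-increasing as a function of $k$ variables (i.e. all volumes of $k$-boxes in its domain are $\ge 0$). $\mathrm{MPV}(d,k)$ denotes the maximal positive volume, i.e. the maximum of $V_Q(\mathcal B)$ over all $d$-boxes $\mathcal B\subseteq[0,1]^d$ and all $k$-increasing $d$-variate quasi-copulas $Q$. The numbers $\gamma_i^{(j)},\alpha_i^{(j)}$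 (for $j=2,\ldots,k$, $i=2,\ldots,d$) are defined recursively by: - $\gamma_i^{(2)}=d+1-i$ and $\alpha_i^{(2)}=1$ for $i=2,\ldots,d$; - for $j=3,\ldots,k$: $\gamma_i^{(j)}=\gamma_i^{(j-1)}$ and $\alpha_i^{(j)}=\alpha_i^{(j-1)}$ for $i=2,\ldots,j-2$; - for $j=3,\ldots,k$: $\gamma_i^{(j)}=\sum_{\ell=i}^d\gamma_\ell^{(j-1)}$ and $\alpha_i^{(j)}=\sum_{\ell=i}^d\alpha_\ell^{(j-1)}$ for $i=j-1,\ldots,d$. *)

(* Defs.v *)
(* Written with MathComp and the abstract real numbers (realType) of
   MathComp-Analysis. *)
From HB Require Import structures.
From mathcomp Require Import all_boot all_order all_algebra.
From mathcomp Require Import boolp classical_sets reals.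

Set Implicit Arguments.
Unset Strict Implicit.
Unset Printing Implicit Defensive.

Import Order.TTheory GRing.Theory Num.Theory.

Local Open Scope ring_scope.

(* Points of R^d are finite functions on an arbitrary finite index type I of
   cardinal d, so that a section over a set A of coordinates is again such a
   function, of index type {j : I | j \in A}.  A function on [0,1]^I is a total
   function of which only the values on the unit cube are ever used. *)
Definition vec (R : realType) (I : finType) : Type := {ffun I -> R}.

Definition cvec {R : realType} {I : finType} (c : R) : vec R I :=
  [ffun=> c].

Definition in_cube (R : realType) (I : finType) (u : vec R I) : Prop :=
  forall i, 0 <= u i <= 1.

(* The box \prod_i [a_i, b_i] is a (possibly degenerate) box inside [0,1]^I. *)
Definition is_box (R : realType) (I : finType) (a b : vec R I) : Prop :=
  [/\ in_cube a, in_cube b & forall i, a i <= b i].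

(* The vertex whose lower coordinates are those in S. *)
Definition vertex (R : realType) (I : finType) (a b : vec R I)
    (S : {set I}) : vec R I :=
  [ffun i => if i \in S then a i else b i].

(* On a nondegenerate box, S |-> vertex a b S is a bijection onto the vertices
   and #|S| is the number of coordinates equal to those of a; on a degenerate
   box the terms cancel in pairs and the sum is 0. *)
Definition volume (R : realType) (I : finType) (F : vec R I -> R)
    (a b : vec R I) : R :=
  \sum_(S : {set I}) (-1) ^+ #|S| * F (vertex a b S).

Definition increasing (R : realType) (I : finType) (F : vec R I -> R) : Prop :=
  forall a b : vec R I, is_box a b -> 0 <= volume F a b.

(* Coordinates in A vary with z, the others are fixed to those of a. *)
Definition section (R : realType) (I : finType) (F : vec R I -> R)
    (A : {set I}) (a : vec R I) : vec R {j : I | j \in A} -> R :=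
  fun z => F [ffun j => if insub j is Some s then z s else a j].

Definition k_increasing (R : realType) (I : finType) (k : nat)
    (F : vec R I -> R) : Prop :=
  forall (A : {set I}) (a : vec R I),
    #|A| = k -> in_cube a -> increasing (section F (A := A) a).

Record quasi_copula (R : realType) (d : nat) (Q : vec R 'I_d -> R) : Prop := {
  qc_range : forall u, in_cube u -> 0 <= Q u <= 1;
  qc_grounded : forall u, in_cube u -> (exists i, u i = 0) -> Q u = 0;
  qc_margin : forall i (t : R), 0 <= t <= 1 ->
    Q [ffun j => if j == i then t else 1] = t;
  qc_monotone : forall u v i, in_cube u -> in_cube v ->
    (forall j, j != i -> u j = v j) -> u i <= v i -> Q u <= Q v;
  qc_lipschitz : forall u v, in_cube u -> in_cube v ->
    `|Q u - Q v| <= \sum_i `|u i - v i|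
}.

Local Open Scope classical_set_scope.

Definition volumes (R : realType) (d k : nat) : set R :=
  [set v | exists (Q : vec R 'I_d -> R) (a b : vec R 'I_d),
     [/\ quasi_copula Q, k_increasing k Q, is_box a b & v = volume Q a b]].
Arguments volumes R d k : clear implicits.

Definition is_maximum (R : realType) (E : set R) (m : R) : Prop :=
  E m /\ ubound E m.

Definition MPV (R : realType) (d k : nat) : R := sup (volumes R d k).
Arguments MPV R d k : clear implicits.

Local Close Scope classical_set_scope.

(* tail_sums d f n is the family at level j = n + 2 of the recursion started at
   level 2 with f; at that level the indices i <= j - 2 are left unchanged. *)
Fixpoint tail_sums (d : nat) (f : nat -> nat) (n i : nat) : nat :=
  if n is m.+1 then
    if (i <= n)%N then tail_sums d f m i
    else (\sum_(i <= l < d.+1) tail_sums d f m l)%N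
  else f i.

(* gamma d j i and alpha d j i are meaningful for 2 <= j <= d and 2 <= i <= d. *)
Definition gamma (d j i : nat) : nat :=
  tail_sums d (fun i => d + 1 - i)%N (j - 2) i.

Definition alpha (d j i : nat) : nat := tail_sums d (fun=> 1%N) (j - 2) i.

Definition mpv_term (R : realType) (d k i : nat) : R :=
  (-1) ^+ (d - i) * 'C(d - k, i - k)%:R * (gamma d k i)%:R^-1.
Arguments mpv_term R d k i : clear implicits.

(* Main.v *)
Require Import Defs.
From HB Require Import structures.
From mathcomp Require Import all_boot all_order all_algebra.
From mathcomp Require Import boolp classical_sets reals.
From mathcomp Require Import fingroup perm ring lra zify fintype finset.

Set Implicit Arguments.
Unset Strict Implicit.
Unset Printing Implicit Defensive.

Import Order.TTheory GRing.Theory Num.Theory.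

Local Open Scope ring_scope.

(* Let L be the linear functional on polynomials with L('X^i) = q_i, so that
   multiplication by 'X - 1 is the forward difference of q.

   Upper bound: averaging Q over the vertices of a box with i upper coordinates
   gives q_0, ..., q_d with V_Q = L(('X - 1)^d).  As Q is k-increasing and
   grounded, w_i := L('X^i ('X - 1)^k) >= 0 for i <= d - k and
   L(('X - 1)^j) >= 0 for j < k.  Expanding ('X - 1)^(d - k) expresses V_Q as a
   combination of the w_i, and the Taylor expansion of 'X^d at 1 bounds
   sum_i gamma_(i + k) w_i by q_d <= 1, since
   gamma_i^(k) = 'C(d - i + k - 1, k - 1); comparing coefficients gives
   V_Q <= M q_d, with M the claimed maximum, which is nonnegative.

   Sharpness: the sequence with w_(i0 - k) = 1 / gamma_i0 and all other w_i = 0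
   has nonnegative differences up to order k, satisfies q_d = 1, and
   a = q_(d - 1).  Interpolating multilinearly the function on {0, a, 1}^d that
   vanishes when some coordinate is 0 and is q_i at the points of {a, 1}^d with
   i ones gives the quasi-copula, Q(u) = L(prod_j g(u_j)) with g piecewise
   linear; an increment of g is a nonnegative combination of 1 and 'X - 1,
   hence Q is k-increasing. *)

(** * The umbral functional of a sequence *)

Definition umbral (R : comNzRingType) (q : nat -> R) (p : {poly R}) : R :=
  \sum_(i < size p) p`_i * q i.

Lemma umbral_widen (R : comNzRingType) (q : nat -> R) (p : {poly R}) n :
  (size p <= n)%N -> umbral q p = \sum_(i < n) p`_i * q i.
Proof.
move=> le_pn; rewrite /umbral (big_ord_widen n (fun i => p`_i * q i)) //.
rewrite big_mkcond /=; apply: eq_bigr => i _; case: ltnP => // le_pi.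
by rewrite nth_default ?mul0r.
Qed.

Lemma umbral_is_linear (R : comNzRingType) (q : nat -> R) :
  linear_for *%R (umbral q).
Proof.
move=> c p r; pose n := maxn (size p) (size r).
have le_cp : (size (c *: p + r)%R <= n)%N.
  apply: (leq_trans (size_polyD _ _)).
  by rewrite geq_max !leq_max size_scale_leq leqnn orbT.
rewrite (umbral_widen _ le_cp) (umbral_widen q (leq_maxl _ _ : size p <= n)%N).
rewrite (umbral_widen q (leq_maxr _ _ : size r <= n)%N) mulr_sumr -big_split /=.
by apply: eq_bigr => i _; rewrite coefD coefZ mulrDl mulrA.
Qed.

HB.instance Definition _ (R : comNzRingType) (q : nat -> R) :=
  GRing.isLinear.Build R {poly R} R *%R (umbral q) (umbral_is_linear q).

Lemma umbralXn (R : comNzRingType) (q : nat -> R) i : umbral q 'X^i = q i.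
Proof.
rewrite /umbral size_polyXn big_ord_recr /= coefXn eqxx mul1r big1 ?add0r // => j _.
by rewrite coefXn ltn_eqF ?mul0r.
Qed.

Lemma umbral_scale (R : comNzRingType) (c : R) (q : nat -> R) (p : {poly R}) :
  umbral (fun i => q i * c) p = umbral q p * c.
Proof. by rewrite /umbral mulr_suml; apply: eq_bigr => i _; rewrite mulrA. Qed.

(** The factor [p] lets a product be absorbed one factor at a time, starting from [p = 1], where the
    condition says that all differences of [q] of order at most [n] are nonnegative. *)
Definition up_to_order_monotone (R : realFieldType) (q : nat -> R) (n : nat)
    (p : {poly R}) : Prop :=
  forall i j, (j <= n)%N -> 0 <= umbral q (p * ('X^i * ('X - 1) ^+ j)).

(** A factor ['X] only moves [i] to [i.+1], so no order is lost. *)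
Lemma monotone_mul_shift (R : realFieldType) (q : nat -> R) n (p : {poly R}) (x y : R) :
  0 <= x -> 0 <= y -> up_to_order_monotone q n p ->
  up_to_order_monotone q n (p * (x%:P + y *: 'X)).
Proof.
move=> x0 y0 Hp i j lejn.
have -> : p * (x%:P + y *: 'X) * ('X^i * ('X - 1) ^+ j)
  = x *: (p * ('X^i * ('X - 1) ^+ j)) + y *: (p * ('X^(i.+1) * ('X - 1) ^+ j)).
  by rewrite -!mul_polyC exprS; ring.
by rewrite linearD !linearZ /= addr_ge0 // mulr_ge0 // Hp.
Qed.

(** A factor ['X - 1] raises [j] by one, so it costs one order. *)
Lemma monotone_mul_diff (R : realFieldType) (q : nat -> R) n (p : {poly R}) (x y : R) :
  0 <= x -> 0 <= y -> up_to_order_monotone q n.+1 p ->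
  up_to_order_monotone q n (p * (x%:P + y *: ('X - 1))).
Proof.
move=> x0 y0 Hp i j lejn.
have -> : p * (x%:P + y *: ('X - 1)) * ('X^i * ('X - 1) ^+ j)
  = x *: (p * ('X^i * ('X - 1) ^+ j)) + y *: (p * ('X^i * ('X - 1) ^+ j.+1)).
  by rewrite -!mul_polyC exprS; ring.
rewrite linearD !linearZ /= addr_ge0 // mulr_ge0 // Hp //.
by rewrite leqW.
Qed.

Lemma monotone_prod_shift (R : realFieldType) (q : nat -> R) n (p : {poly R})
    (I : Type) (s : seq I) (P : pred I) (x y : I -> R) :
  (forall i, 0 <= x i) -> (forall i, 0 <= y i) -> up_to_order_monotone q n p ->
  up_to_order_monotone q n (p * \prod_(i <- s | P i) ((x i)%:P + y i *: 'X)).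
Proof.
move=> x0 y0; elim: s p => [|i s IHs] p Hp; first by rewrite big_nil mulr1.
rewrite big_cons; case: (P i); last exact: IHs.
by rewrite mulrA; apply: IHs; apply: monotone_mul_shift.
Qed.

Lemma monotone_prod_diff (R : realFieldType) (q : nat -> R) n (p : {poly R})
    (I : Type) (s : seq I) (x y : I -> R) :
  (forall i, 0 <= x i) -> (forall i, 0 <= y i) ->
  up_to_order_monotone q (size s + n) p ->
  up_to_order_monotone q n (p * \prod_(i <- s) ((x i)%:P + y i *: ('X - 1))).
Proof.
move=> x0 y0; elim: s p => [|i s IHs] p Hp; first by rewrite big_nil mulr1.
by rewrite big_cons mulrA; apply: IHs; apply: monotone_mul_diff.
Qed.

(** * Faces of boxes *)

(** Coordinates outside [A] stay at [b]. Faces live in the ambient space, which avoids the subtype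
    indices of sections. *)
Definition face (R : realType) (I : finType) (F : vec R I -> R) (a b : vec R I)
    (A : {set I}) : R :=
  \sum_(S : {set I} | S \subset A) (-1) ^+ #|S| * F (vertex a b S).

Lemma faceT (R : realType) (I : finType) (F : vec R I -> R) (a b : vec R I) :
  face F a b setT = volume F a b.
Proof. by apply: eq_bigl => S; rewrite subsetT. Qed.

Definition restriction (R : realType) (I : finType) (A : {set I}) (a : vec R I) :
  vec R {j : I | j \in A} := [ffun s => a (val s)].

Definition extension (R : realType) (I : finType) (A : {set I}) (c : vec R I)
    (x : vec R {j : I | j \in A}) : vec R I :=
  [ffun j => if insub j is Some s then x s else c j].

Lemma extensionK (R : realType) (I : finType) (A : {set I}) (c : vec R I)
    (x : vec R {j : I | j \in A}) : restriction A (extension c x) = x.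
Proof. by apply/ffunP => s; rewrite !ffunE valK. Qed.

Lemma volume_section (R : realType) (I : finType) (F : vec R I -> R)
    (A : {set I}) (a b : vec R I) :
  volume (section F (A := A) b) (restriction A a) (restriction A b) = face F a b A.
Proof.
rewrite /volume /face.
rewrite (reindex_onto (fun S : {set {j : I | j \in A}} => val @: S)
  (fun S : {set I} => [set s | val s \in S])) /=; last first.
  move=> S /subsetP sSA; apply/setP => j; apply/imsetP/idP.
    by case=> s; rewrite inE => sS ->.
  by move=> jS; exists (Sub j (sSA j jS)); rewrite ?inE SubK.
apply: eq_big => [S|S _].
  rewrite (_ : [set _ | _] = S) ?eqxx ?andbT; last first.
    by apply/setP => s; rewrite inE mem_imset //; apply: val_inj.
  by apply/esym/subsetP => _ /imsetP [s _ ->]; apply: valP.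
rewrite card_imset; last exact: val_inj.
congr (_ * F _); apply/ffunP => j; rewrite !ffunE; case: insubP => [s _ <-|jA].
  by rewrite !ffunE mem_imset //; apply: val_inj.
rewrite ifN //; apply/imsetP => -[s _ js].
by case/negP: jA; rewrite js; apply: valP.
Qed.

Lemma section_extension (R : realType) (I : finType) (F : vec R I -> R)
    (A : {set I}) (c : vec R I) (x : vec R {j : I | j \in A}) :
  section F (A := A) (extension c x) = section F (A := A) c.
Proof.
rewrite /section; apply/funext => z; congr F; apply/ffunP => j.
by rewrite !ffunE; case: insubP.
Qed.

(** For the converse, both corners of a box of the section are extended by the same [c]; this gives
    a box in the cube whose face along [A] is the given volume. *)
Lemma k_increasingP (R : realType) (I : finType) (F : vec R I -> R) (k : nat) :
  k_increasing k F <->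
  (forall (A : {set I}) (a b : vec R I), #|A| = k -> is_box a b -> 0 <= face F a b A).
Proof.
split=> [incF A a b cardA [a01 b01 le_ab]|faceF A c cardA c01 x y [x01 y01 le_xy]].
  rewrite -volume_section; apply: incF => //.
  by split=> s; rewrite !ffunE.
rewrite -(section_extension F c y) -(extensionK c x) -{2}(extensionK c y).
rewrite volume_section; apply: faceF => //.
by split=> j; rewrite !ffunE; case: insubP.
Qed.

(* A face of dimension less than k is the face of dimension k obtained by
   letting further coordinates start from 0, where F vanishes. *)
Lemma face_ge0 (R : realType) (I : finType) (F : vec R I -> R) (k : nat)
    (A : {set I}) (a b : vec R I) :
  (forall u, in_cube u -> (exists i, u i = 0) -> F u = 0) ->
  k_increasing k F -> (#|A| <= k <= #|I|)%N -> is_box a b -> 0 <= face F a b A.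
Proof.
move=> F0 /k_increasingP incF /andP [leAk lekI] [a01 b01 le_ab].
have [B sAB cardB] : exists2 B : {set I}, A \subset B & #|B| = k.
  elim: k leAk lekI {incF} => [|k IHk] leAk lekI.
    by exists A => //; apply/eqP; rewrite -leqn0.
  have [eqA|neqA] := eqVneq #|A| k.+1; first by exists A.
  have [||B sAB cardB] := IHk; [by rewrite -ltnS ltn_neqAle neqA | exact: ltnW |].
  have [i iB] : exists i, i \notin B.
    apply/existsP; rewrite -negb_forall; apply/negP => /forallP allB.
    move: lekI; rewrite -cardB -cardsT ltnNge subset_leq_card //.
    by apply/subsetP => i _; apply: allB.
  exists (i |: B); first exact: subset_trans sAB (subsetUr _ _).
  by rewrite cardsU1 iB cardB.
pose a' : vec R I := [ffun i => if i \in B :\: A then 0 else a i].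
have box' : is_box a' b.
  split=> // i; rewrite ffunE; case: ifP => // _; first by rewrite lexx ler01.
  by case/andP: (b01 i).
suff -> : face F a b A = face F a' b B by apply: incF.
rewrite /face [RHS](bigID (fun S : {set I} => S \subset A)) /=.
rewrite [X in _ + X]big1 ?addr0 => [|S /andP [/subsetP sSB]].
  apply: eq_big => S; first by case: (boolP (S \subset A)) => [/subset_trans->|]; rewrite ?andbF.
  move=> sSA; congr (_ * F _); apply/ffunP => i; rewrite !ffunE.
  by case: ifP => // /(subsetP sSA) iA; rewrite !inE iA.
case/subsetPn => i iS iA; rewrite F0 ?mulr0 //; last first.
  by exists i; rewrite !ffunE iS !inE iA sSB.
by case: box' => a'01 _ _ j; rewrite ffunE; case: ifP.
Qed.

(** * Quasi-copulas from the sign of low-dimensional faces *)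

Definition update (R : realType) (I : finType) (u : vec R I) (i : I) (t : R) :
  vec R I := [ffun j => if j == i then t else u j].

Lemma update_in_cube (R : realType) (I : finType) (u : vec R I) i (t : R) :
  in_cube u -> 0 <= t <= 1 -> in_cube (update u i t).
Proof. by move=> u01 t01 j; rewrite ffunE; case: ifP. Qed.

Lemma face0 (R : realType) (I : finType) (F : vec R I -> R) (a b : vec R I) :
  face F a b set0 = F b.
Proof.
rewrite /face (eq_bigl (pred1 set0)) => [|S]; last by rewrite subset0.
rewrite big_pred1_eq cards0 mul1r; congr F.
by apply/ffunP => i; rewrite ffunE inE.
Qed.

(** Split the subsets by membership of [i]. Applied twice, this turns a two-dimensional face into a
    mixed second difference. *)
Lemma faceU1 (R : realType) (I : finType) (F : vec R I -> R) (a b : vec R I)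
    (i : I) (A : {set I}) : i \notin A ->
  face F a b (i |: A) = face F a b A - face F a (update b i (a i)) A.
Proof.
move=> iA; rewrite /face (bigID (fun S : {set I} => i \notin S)) /=; congr (_ + _).
  by apply: eq_bigl => S; rewrite -subsetD1 setU1K.
under eq_bigl do rewrite negbK.
rewrite (reindex_onto (fun S => i |: S) (fun S => S :\ i)) /=; last first.
  by move=> S /andP [_]; apply: setD1K.
rewrite -sumrN; apply: eq_big => [S|S].
  rewrite setU11 andbT; apply/andP/idP => [[sSA /eqP eqS]|sSA].
    by rewrite -eqS -(setU1K iA) setSD.
  by rewrite setUS // setU1K //; apply: contra iA; apply: subsetP.
case/andP => _ /eqP eqS.
have iS : i \notin S by rewrite -eqS !inE eqxx.
rewrite cardsU1 iS exprS mulN1r mulNr; congr (- (_ * F _)).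
by apply/ffunP => j; rewrite !ffunE !inE; case: eqP => [->|] //=; case: ifP.
Qed.

Lemma face1 (R : realType) (I : finType) (F : vec R I -> R) (a b : vec R I) (i : I) :
  face F a b [set i] = F b - F (update b i (a i)).
Proof. by rewrite -(setU0 [set i]) faceU1 ?inE // !face0. Qed.

(** Telescoping along a path from [u] to [v] that changes one coordinate at a time. It serves both
    for monotonicity ([c = 0]) and for the Lipschitz bound. *)
Lemma le_sum_coordinatewise (R : realType) (I : finType) (F : vec R I -> R)
    (u v : vec R I) (c : I -> R) :
  in_cube u -> in_cube v ->
  (forall (w : vec R I) i, in_cube w -> w i = u i -> F (update w i (v i)) - F w <= c i) ->
  F v - F u <= \sum_i c i.
Proof.
move=> u01 v01 Fc; pose mix (s : seq I) : vec R I := [ffun i => if i \in s then v i else u i].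
have -> : v = mix (index_enum I) by apply/ffunP => i; rewrite ffunE mem_index_enum.
have : uniq (index_enum I) by exact: index_enum_uniq.
elim: (index_enum I) => [_|i s IHs /andP [is_ /IHs IH]].
  by rewrite big_nil (_ : mix [::] = u) ?subrr //; apply/ffunP => i; rewrite ffunE.
rewrite big_cons; have -> : mix (i :: s) = update (mix s) i (v i).
  by apply/ffunP => j; rewrite !ffunE inE; case: eqP => [->|].
have := Fc (mix s) i; rewrite ffunE (negbTE is_) => /(_ _ erefl) Fi.
have /Fi : in_cube (mix s) by move=> j; rewrite ffunE; case: ifP.
by move: IH; lra.
Qed.

(** As [k] is at least 2, faces of dimension 1 and 2 are nonnegative. Dimension 1 gives
    monotonicity. Dimension 2 makes the increment in one coordinate nondecreasing in the others,
    hence at most the increment [t - s] of the margin. *)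
Lemma k_increasing_quasi_copula (R : realType) (d k : nat) (Q : vec R 'I_d -> R) :
  (2 <= k <= d)%N -> k_increasing k Q ->
  (forall u, in_cube u -> (exists i, u i = 0) -> Q u = 0) ->
  (forall i (t : R), 0 <= t <= 1 -> Q [ffun j => if j == i then t else 1] = t) ->
  quasi_copula Q.
Proof.
case/andP => k2 kd incQ Q0 Q1.
have face2_ge0 (A : {set 'I_d}) (a b : vec R 'I_d) :
    (#|A| <= 2)%N -> is_box a b -> 0 <= face Q a b A.
  by move=> leA2; apply: face_ge0 Q0 incQ _; rewrite (leq_trans leA2) //= card_ord.
have mono (w : vec R 'I_d) i (s : R) :
    in_cube w -> 0 <= s <= 1 -> w i <= s -> Q w <= Q (update w i s).
  move=> w01 s01 le_ws; rewrite -subr_ge0.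
  have -> : Q w = Q (update (update w i s) i (w i)).
    by congr Q; apply/ffunP => j; rewrite !ffunE; case: eqP => // ->.
  rewrite -face1; apply: face2_ge0; first by rewrite cards1.
  split=> //; first exact: update_in_cube.
  by move=> j; rewrite ffunE; case: eqP => [->|].
have one01 : in_cube (cvec 1 : vec R 'I_d).
  by move=> j; rewrite ffunE ler01 lexx.
have lip (w : vec R 'I_d) i (s t : R) : in_cube w -> 0 <= s -> s <= t -> t <= 1 ->
    Q (update w i t) - Q (update w i s) <= t - s.
  move=> w01 s0 st t1.
  have t01 : 0 <= t <= 1 by rewrite (le_trans s0 st).
  have s01 : 0 <= s <= 1 by rewrite s0 (le_trans st t1).
  pose G (u : vec R 'I_d) := Q (update u i t) - Q (update u i s).
  have G1 : G (cvec 1) = t - s.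
    rewrite /G -{2}(Q1 i t t01) -{2}(Q1 i s s01); congr (Q _ - Q _);
      by apply/ffunP => j; rewrite !ffunE.
  rewrite -G1 -subr_ge0.
  have := @le_sum_coordinatewise _ _ (fun u => - G u) w (cvec 1) (fun=> 0) w01 one01.
  rewrite big1 // => Gle; suff : - G (cvec 1) - - G w <= 0 by rewrite /G; lra.
  apply: Gle => u j u01 _.
  have [->|ji] := eqVneq j i.
    have -> : G (update u i ((cvec 1 : vec R 'I_d) i)) = G u; last by lra.
    by congr (Q _ - Q _); apply/ffunP => l; rewrite !ffunE; case: eqP.
  (* This face equals [G (update u j 1) - G u]. *)
  have : 0 <= face Q (update u i s) (update (update u i t) j 1) (j |: [set i]).
    apply: face2_ge0; first by rewrite cards2; case: (_ != _).
    split; first exact: update_in_cube.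
      by apply: update_in_cube; rewrite ?ler01 ?lexx //; apply: update_in_cube.
    move=> l; rewrite !ffunE; case: (eqVneq l j) => [->|].
      by rewrite (negbTE ji); case/andP: (u01 j).
    by move=> _; case: eqP => // _; rewrite lexx.
  rewrite faceU1 ?inE // !face1 /G !ffunE eqxx (negbTE ji).
  have -> : update (update (update (update u i t) j 1) j (u j)) i s = update u i s.
    apply/ffunP => l; rewrite !ffunE; case: (eqVneq l i) => [//|_].
    by case: (eqVneq l j) => [->|].
  have -> : update (update (update u i t) j 1) j (u j) = update u i t.
    by apply/ffunP => l; rewrite !ffunE; case: (eqVneq l j) => [->|//]; rewrite (negbTE ji).
  have -> : update (update (update u i t) j 1) i s = update (update u j 1) i s.
    by apply/ffunP => l; rewrite !ffunE; case: (eqVneq l i).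
  have -> : update (update u i t) j 1 = update (update u j 1) i t.
    apply/ffunP => l; rewrite !ffunE; case: (eqVneq l i) => [->|//].
    by rewrite eq_sym (negbTE ji).
  lra.
have mono_all (u v : vec R 'I_d) : in_cube u -> in_cube v ->
    (forall j, u j <= v j) -> Q u <= Q v.
  move=> u01 v01 le_uv; rewrite -lerN2 -subr_ge0 opprK.
  have := @le_sum_coordinatewise _ _ (fun u => - Q u) u v (fun=> 0) u01 v01.
  rewrite big1 // => Qle; suff : - Q v - - Q u <= 0 by lra.
  apply: Qle => w i w01 wi; have := mono w i (v i) w01 (v01 i).
  by rewrite wi le_uv => /(_ isT); lra.
have lip_all (u v : vec R 'I_d) : in_cube u -> in_cube v ->
    Q v - Q u <= \sum_i `|u i - v i|.
  move=> u01 v01; apply: le_sum_coordinatewise => // w i w01 wi.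
  case/andP: (u01 i) => ui0 ui1; case/andP: (v01 i) => vi0 vi1.
  have w_i : update w i (u i) = w.
    by apply/ffunP => j; rewrite ffunE; case: eqP => // ->.
  have [le_uv|/ltW le_vu] := lerP (u i) (v i).
    have := lip w i _ _ w01 ui0 le_uv vi1; rewrite w_i; lra.
  have vw01 : in_cube (update w i (v i)) by exact: update_in_cube.
  have := mono (update w i (v i)) i (u i) vw01 (u01 i).
  rewrite ffunE eqxx => /(_ le_vu).
  rewrite (_ : update _ i (u i) = w) => [|]; first by lra.
  by apply/ffunP => j; rewrite !ffunE; case: eqP => // ->.
have d0 : (0 < d)%N by exact: leq_trans (ltnW k2) kd.
have zero01 : in_cube (cvec 0 : vec R 'I_d) by move=> j; rewrite ffunE ler01 lexx.
split=> //.
- move=> u u01; apply/andP; split.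
    rewrite -(Q0 (cvec 0)) //; last by exists (Ordinal d0); rewrite ffunE.
    by apply: mono_all => // j; rewrite ffunE; case/andP: (u01 j).
  have := Q1 (Ordinal d0) 1; rewrite lexx ler01 => /(_ isT) <-.
  apply: mono_all => // [j|j]; rewrite ffunE if_same; first by rewrite ler01 lexx.
  by case/andP: (u01 j).
- move=> u v i u01 v01 eq_uv le_uv; apply: mono_all => // j.
  by have [->|/eq_uv ->] := eqVneq j i.
- move=> u v u01 v01; rewrite ler_norml lerNl opprB lip_all //.
  by rewrite (eq_bigr _ (fun i _ => distrC _ _)) lip_all.
Qed.

(** * Multilinear interpolation of sequences *)

(** By linearity the signed sum over vertices is the expansion of a product of differences. Writing
    the factors outside [A] as [0 + g (y i)] kills the subsets not contained in [A]. *)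
Lemma face_umbral_prod (R : realType) (I : finType) (q : nat -> R)
    (g : R -> {poly R}) (x y : vec R I) (A : {set I}) :
  face (fun u => umbral q (\prod_i g (u i))) x y A =
  umbral q (\prod_(i in ~: A) g (y i) * \prod_(i in A) (g (y i) - g (x i))).
Proof.
have -> : \prod_(i in ~: A) g (y i) * \prod_(i in A) (g (y i) - g (x i)) =
    \prod_i ((if i \in A then - g (x i) else 0) + g (y i)).
  rewrite [RHS](bigID (mem A)) mulrC /=; congr (_ * _).
    by apply: eq_bigr => i ->; rewrite addrC.
  by apply: eq_big => i; [rewrite inE | rewrite inE => /negbTE ->; rewrite add0r].
rewrite bigA_distr linear_sum /= /face [RHS](bigID (fun S : {set I} => S \subset A)) /=.
rewrite [X in _ + X]big1 ?addr0 => [|S /subsetPn [i iS iA]]; last first.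
  by rewrite (bigD1 i) //= iS (negbTE iA) mul0r linear0.
apply: eq_bigr => S /subsetP sSA.
have <- : umbral q ((-1) ^+ #|S| *: \prod_i g (vertex x y S i)) =
    (-1) ^+ #|S| * umbral q (\prod_i g (vertex x y S i)) by rewrite linearZ.
rewrite -mul_polyC rmorphXn rmorphN1 (bigID (mem S)) /= mulrA -prodrN.
congr (umbral q _); rewrite [RHS](bigID (mem S)) /=; congr (_ * _).
  by apply: eq_bigr => i iS; rewrite ffunE iS sSA.
by apply: eq_bigr => i /negbTE iS; rewrite ffunE iS.
Qed.

(* The piecewise linear weights of the two upper nodes of the grid {0, a, 1}:
   rise is their sum and slope the weight of the node 1.  For a = 0 the junk
   value 0 / 0 = 0 gives rise a 0 = 0, as needed. *)
Definition rise (R : realType) (a t : R) : R := if t <= a then t / a else 1.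

Definition slope (R : realType) (a t : R) : R :=
  if t <= a then 0 else (t - a) / (1 - a).

(** For [0 < a < 1] this is the piecewise linear map with values 0, 1 and ['X] at the nodes 0, [a]
    and 1. *)
Definition interpolant (R : realType) (a t : R) : {poly R} :=
  (rise a t)%:P + slope a t *: ('X - 1).

Lemma interpolantE (R : realType) (a t : R) :
  interpolant a t = (rise a t - slope a t)%:P + slope a t *: 'X.
Proof. by rewrite /interpolant polyCB -!mul_polyC; ring. Qed.

Lemma interpolantB (R : realType) (a s t : R) :
  interpolant a t - interpolant a s =
  (rise a t - rise a s)%:P + (slope a t - slope a s) *: ('X - 1).
Proof. by rewrite /interpolant !polyCB -!mul_polyC !polyCB; ring. Qed.

Lemma slope_ge0 (R : realType) (a t : R) : a < 1 -> 0 <= slope a t.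
Proof.
move=> a1; rewrite /slope; case: (lerP t a) => //= ta.
by rewrite divr_ge0 // subr_ge0 ltW.
Qed.

Lemma slope_nondecreasing (R : realType) (a s t : R) :
  a < 1 -> s <= t -> slope a s <= slope a t.
Proof.
move=> a1 st; rewrite {1}/slope; case: (lerP s a) => sa; first exact: slope_ge0.
rewrite /slope ifN -?ltNge ?(lt_le_trans sa st) // ler_pM2r ?invr_gt0 ?subr_gt0 //.
by rewrite lerD2r.
Qed.

Lemma rise_le1 (R : realType) (a t : R) : 0 <= a -> t <= a -> t / a <= 1.
Proof.
rewrite le_eqVlt => /orP [/eqP <-|a0] ta; first by rewrite invr0 mulr0 ler01.
by rewrite ler_pdivrMr // mul1r.
Qed.

Lemma rise_nondecreasing (R : realType) (a s t : R) :
  0 <= a -> s <= t -> rise a s <= rise a t.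
Proof.
move=> a0 st; rewrite /rise; case: (lerP t a) => ta.
  by rewrite (le_trans st ta) ler_wpM2r // invr_ge0.
by case: (lerP s a) => // sa; apply: rise_le1.
Qed.

Lemma slope_le_rise (R : realType) (a t : R) :
  0 <= a < 1 -> 0 <= t <= 1 -> slope a t <= rise a t.
Proof.
case/andP => a0 a1 /andP [t0 t1]; rewrite /slope /rise; case: (lerP t a) => ta.
  by rewrite divr_ge0.
by rewrite ler_pdivrMr ?subr_gt0 // mul1r lerD2r.
Qed.

Lemma interpolant0 (R : realType) (a : R) : 0 <= a -> interpolant a 0 = 0.
Proof. by move=> a0; rewrite /interpolant /rise /slope a0 mul0r scale0r addr0. Qed.

Lemma interpolant1 (R : realType) (a : R) : a < 1 -> interpolant a 1 = 'X.
Proof.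
move=> a1; rewrite /interpolant /rise /slope leNgt a1 /=.
by rewrite divff ?subr_eq0 ?gt_eqF // scale1r; ring.
Qed.

Lemma interpolant_node (R : realType) (a : R) : a != 0 -> interpolant a a = 1.
Proof. by move=> a0; rewrite /interpolant /rise /slope lexx divff // scale0r addr0. Qed.

(** The choice [a = q d.-1] makes the margins right: with [q d = 1], the value at [t] is
    [(rise a t - slope a t) * a + slope a t], which is [t]. *)
Lemma interpolation (R : realType) (d k : nat) (q : nat -> R) :
  (2 <= k <= d)%N -> up_to_order_monotone q k 1 -> q d = 1 -> q d.-1 < 1 ->
  exists Q : vec R 'I_d -> R,
    [/\ quasi_copula Q, k_increasing k Q &
      forall z : vec R 'I_d, (forall j, z j = q d.-1 \/ z j = 1) ->
        Q z = q (d - #|[set j : 'I_d | z j == q d.-1]|)%N].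
Proof.
move=> kd monq qd; set a := q d.-1 => a1.
have q_ge0 i : 0 <= q i.
  by have := monq i 0 (leq0n k); rewrite mul1r mulr1 umbralXn.
have q_nondecreasing : {homo q : i j / (i <= j)%N >-> i <= j}.
  apply: homo_leq => [//|? ? ?|i]; first exact: le_trans.
  have := monq i 1%N; rewrite mul1r expr1 mulrBr mulr1 -exprSr linearB /= !umbralXn.
  by rewrite subr_ge0; apply; case/andP: kd => /ltnW.
have a0 : 0 <= a := q_ge0 _.
pose Q (u : vec R 'I_d) := umbral q (\prod_i interpolant a (u i)).
have Q0 u : in_cube u -> (exists i, u i = 0) -> Q u = 0.
  by move=> _ [i ui]; rewrite /Q (bigD1 i) //= ui interpolant0 // mul0r linear0.
have Qcorner (P : pred 'I_d) (u : vec R 'I_d) :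
    (forall i, interpolant a (u i) = if P i then 1 else 'X) -> Q u = q (d - #|P|)%N.
  move=> uE; rewrite /Q (eq_bigr (fun i => if predC P i then 'X else 1)); last first.
    by move=> i _; rewrite uE /=; case: (P i).
  rewrite -big_mkcond prodr_const umbralXn; congr q.
  by rewrite -[X in (X - _)%N](card_ord d) -(cardC P) addKn.
have incQ : k_increasing k Q.
  apply/k_increasingP => A x y cardA [x01 y01 le_xy].
  rewrite /Q face_umbral_prod.
  under [X in umbral q (_ * X)]eq_bigr do rewrite interpolantB.
  rewrite -[X in _ * X]big_enum /=; set p := (X in umbral q X).
  suff monp : up_to_order_monotone q 0 p by have := monp 0%N 0%N isT; rewrite !mulr1.
  (* Each of the [k] increments uses one order, and the fixed coordinates use none, so order [k] of
     [q] is exactly enough. *)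
  rewrite {}/p; apply: monotone_prod_diff => [i|i|].
  - by rewrite subr_ge0 rise_nondecreasing.
  - by rewrite subr_ge0 slope_nondecreasing.
  - rewrite -cardE cardA addn0 -[X in up_to_order_monotone _ _ X]mul1r.
    under eq_bigr do rewrite interpolantE.
    apply: monotone_prod_shift => // i; last exact: slope_ge0.
    by rewrite subr_ge0 slope_le_rise // a0.
exists Q; split=> //.
- apply: (k_increasing_quasi_copula kd) => // i t t01.
  rewrite /Q (bigD1 i) //= ffunE eqxx.
  rewrite (eq_bigr (fun=> 'X)) => [|j ji]; last by rewrite ffunE (negbTE ji) interpolant1.
  rewrite prodr_const (eq_card (_ : _ =i predC1 i)) // cardC1 card_ord.
  have -> : interpolant a t * 'X^(d.-1) =
      (rise a t - slope a t) *: 'X^(d.-1) + slope a t *: 'X^(d.-1.+1).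
    by rewrite interpolantE -!mul_polyC exprS; ring.
  have d0 : (0 < d)%N := leq_ltn_trans (leq0n i) (ltn_ord i).
  rewrite linearD !linearZ /= !umbralXn prednK // qd -/a mulr1.
  rewrite /rise /slope; case: (lerP t a) => ta.
    have [a_0|a_neq0] := eqVneq a 0; last by field.
    by rewrite a_0 mulr0 add0r; move: t01 ta; rewrite a_0; lra.
  by field; rewrite subr_eq0 gt_eqF.
- move=> z zE; rewrite cardsE.
  have corner : a != 0 \/ (forall j, z j != a) -> Q z = q (d - #|[pred j | z j == a]|)%N.
    move=> az; apply: Qcorner => j; rewrite /=; case: eqP => [zj|/eqP zj].
      by case: az => [a_neq0|/(_ j)]; rewrite ?zj ?eqxx // interpolant_node.
    by case: (zE j) zj => ->; rewrite ?eqxx // interpolant1.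
  (* If [a = 0], the nodes 0 and [a] coincide. At a vertex with a zero coordinate both sides vanish:
     [Q] is grounded, and [q] is nondecreasing with [q d.-1 = 0]. *)
  have [a_0|a_neq0] := eqVneq a 0; last by apply: corner; left.
  have [/forallP nz|] := boolP [forall j, z j != a]; first by apply: corner; right.
  rewrite negb_forall => /existsP [j]; rewrite negbK => /eqP zj.
  rewrite Q0; last by exists j; rewrite zj.
    apply/eqP; rewrite eq_le q_ge0 -a_0 /=; apply: q_nondecreasing.
    rewrite -subn1 leq_sub2l //; apply/card_gt0P; exists j.
    by rewrite unfold_in; apply/eqP.
  by move=> i; case: (zE i) => ->; rewrite ?ler01 ?lexx // a_0 lexx ler01.
Qed.

(** * Binomial sequences *)

(** The hockey-stick identity, by induction on [d - i]. *)
Lemma sum_bin_diag (r d i : nat) : (i <= d)%N ->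
  (\sum_(i <= l < d.+1) 'C(d - l + r, r) = 'C(d - i + r.+1, r.+1))%N.
Proof.
move=> led; have [m ->] : exists m, i = (d - m)%N by exists (d - i)%N; rewrite subKn.
elim: m => [|m IHm]; first by rewrite subn0 big_nat1 subnn !binn.
have [ltmd|ledm] := ltnP m d; last by rewrite (_ : d - m.+1 = d - m)%N ?IHm //; lia.
have e : (d - m.+1).+1 = (d - m)%N by lia.
rewrite big_ltn ?e ?IHm; last by lia.
by rewrite (_ : d - (d - m) + r.+1 = d - (d - m.+1) + r)%N ?addnS ?binS 1?addnC //; lia.
Qed.

(** Each level raises the lower binomial index by one. The bound [n < i] keeps the recursion out of
    its frozen branch. The start is [p = 1] for [gamma] and [p = 0] for [alpha]. *)
Lemma tail_sums_bin (d p : nat) (f : nat -> nat) (n i : nat) :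
  (forall l, (l <= d)%N -> f l = 'C(d - l + p, p)) -> (n < i <= d)%N ->
  tail_sums d f n i = 'C(d - i + (n + p), n + p).
Proof.
move=> fE; elim: n i => [|n IHn] i /andP [lt_ni le_id] /=; first exact: fE.
rewrite leqNgt lt_ni /= addSn -sum_bin_diag // !big_nat.
by apply: eq_bigr => l /andP [le_il]; rewrite ltnS => le_ld; rewrite IHn // le_ld; lia.
Qed.

Lemma gammaE (d k i : nat) : (2 <= k <= i)%N -> (i <= d)%N ->
  gamma d k i = 'C(d - i + k.-1, k.-1).
Proof.
move=> /andP [k2 le_ki] le_id; rewrite /gamma (@tail_sums_bin _ 1); last by lia.
  by rewrite (_ : k - 2 + 1 = k.-1)%N //; lia.
by move=> l le_ld; rewrite bin1; lia.
Qed.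

Lemma alphaE (d k i : nat) : (2 <= k <= i)%N -> (i <= d)%N ->
  alpha d k i = 'C(d - i + k.-2, k.-2).
Proof.
move=> /andP [k2 le_ki] le_id; rewrite /alpha (@tail_sums_bin _ 0); last by lia.
  by rewrite addn0 subn2.
by move=> l le_ld; rewrite bin0.
Qed.

(** * Finite differences and the Taylor expansion at 1 *)

Lemma umbral_diffS (R : comNzRingType) (q : nat -> R) (i j : nat) :
  umbral q ('X^i * ('X - 1) ^+ j.+1) =
  umbral q ('X^(i.+1) * ('X - 1) ^+ j) - umbral q ('X^i * ('X - 1) ^+ j).
Proof. by rewrite -linearB; congr (umbral q _); rewrite /= !exprS; ring. Qed.

Lemma umbral_diff (R : comNzRingType) (q : nat -> R) (i j : nat) :
  umbral q ('X^i * ('X - 1) ^+ j) =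
  \sum_(l < j.+1) 'C(j, l)%:R * ((-1) ^+ l * q (i + j - l)%N).
Proof.
rewrite exprBn mulr_sumr linear_sum /=; apply: eq_bigr => l _.
have le_lj : (l <= j)%N by rewrite -ltnS.
rewrite expr1n mulr1 -(umbralXn q (i + j - l)) -addnBA // exprD.
have -> : 'X^i * ((-1) ^+ l * 'X^(j - l) *+ 'C(j, l)) =
    ('C(j, l)%:R * (-1) ^+ l) *: ('X^i * 'X^(j - l)) :> {poly R}.
  by rewrite -mul_polyC rmorphM rmorphXn rmorphN1 rmorph_nat -mulr_natl; ring.
by rewrite linearZ /= mulrA.
Qed.

(** With [r = ('X - 1) ^+ k], this passes from [q] to the sequence of its [k]-th differences. *)
Lemma umbralM (R : comNzRingType) (q : nat -> R) (p r : {poly R}) :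
  umbral q (p * r) = umbral (fun i => umbral q ('X^i * r)) p.
Proof.
rewrite -{1}[p]coefK poly_def mulr_suml linear_sum /=.
by apply: eq_bigr => i _; rewrite -scalerAl linearZ.
Qed.

Lemma sum_subsets (R : comNzRingType) (T : finType) (A : {set T}) (f : nat -> R) :
  \sum_(S : {set T} | S \subset A) f #|S| = \sum_(l < #|A|.+1) 'C(#|A|, l)%:R * f l.
Proof.
rewrite (partition_big (fun S : {set T} => inord #|S| : 'I_#|A|.+1) predT) //=.
apply: eq_bigr => l _; rewrite -cards_draws mulr_natl -sumr_const.
apply: eq_big => S; last first.
  by case/andP => sSA /eqP <-; rewrite inordK // ltnS subset_leq_card.
rewrite inE; case: (boolP (S \subset A)) => //= sSA.
by rewrite -val_eqE /= inordK // ltnS subset_leq_card.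
Qed.

(** The test matters for [r = 0]: by truncated subtraction the bare binomial would be 1 below [c],
    instead of giving a unit step at [c]. *)
Definition shifted_bin (R : nzRingType) (c r i : nat) : R :=
  (if (c <= i)%N then 'C(i - c, r) else 0%N)%:R.

Lemma umbral_shifted_bin (R : comNzRingType) (c r i j : nat) : (j <= r)%N ->
  umbral (shifted_bin R c r) ('X^i * ('X - 1) ^+ j) = shifted_bin R c (r - j) i.
Proof.
elim: j i => [|j IHj] i le_jr; first by rewrite mulr1 umbralXn subn0.
rewrite umbral_diffS !IHj ?(ltnW le_jr) // /shifted_bin.
rewrite (_ : r - j = (r - j.+1).+1)%N; last by lia.
case: (leqP c i) => [le_ci|lt_ic].
  by rewrite leqW // subSn // binS natrD addrAC subrr add0r.
(* At the border [c = i.+1] the binomial is that of 0 over a positive number. *)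
case: (leqP c i.+1) => [le_ci|_]; last by rewrite subrr.
by rewrite (_ : i.+1 - c = 0)%N ?subrr //; lia.
Qed.

(** After [r] differences a unit step at [c] is left; one more gives a spike just before [c]. *)
Lemma umbral_shifted_bin_top (R : comNzRingType) (c r i : nat) :
  umbral (shifted_bin R c r) ('X^i * ('X - 1) ^+ r.+1) = (i.+1 == c)%:R.
Proof.
rewrite umbral_diffS !umbral_shifted_bin // subnn /shifted_bin.
case: (ltngtP c i.+1) => [lt_ci|lt_ic|->].
- by rewrite -ltnS lt_ci !bin0 subrr.
- by rewrite leqNgt (ltnW lt_ic) subrr.
- by rewrite ltnn bin0 subr0.
Qed.

(** Telescoping of ['C(d - s, k.+1)%:R * 'X^s] combined with Pascal's rule. *)
Lemma sum_bin_expX (R : comNzRingType) (d k : nat) :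
  \sum_(s < d) 'C(d - s.+1, k)%:R * 'X^s = 'C(d, k.+1)%:R +
    ('X - 1) * \sum_(s < d) 'C(d - s.+1, k.+1)%:R * 'X^s :> {poly R}.
Proof.
pose h s : {poly R} := 'C(d - s, k.+1)%:R * 'X^s.
have := telescope_sumr h (leq0n d).
rewrite big_mkord [h d]/h [h 0%N]/h subnn subn0 mulr1 mul0r sub0r.
move=> /(congr1 -%R); rewrite opprK -sumrN => <-.
rewrite mulr_sumr -big_split /=; apply: eq_bigr => s _.
rewrite /h -(subnSK (ltn_ord s)) binS natrD exprS; ring.
Qed.

(** The base case is the geometric sum; [sum_bin_expX] then splits the next Taylor term off the
    remainder. For [s <= d - k] and [2 <= k], the coefficient of ['X^s] in the remainder is
    [gamma d k (s + k)]. *)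
Lemma expX_taylor (R : comNzRingType) (d k : nat) : (0 < k)%N ->
  'X^d = \sum_(j < k) 'C(d, j)%:R * ('X - 1) ^+ j +
         ('X - 1) ^+ k * \sum_(s < d) 'C(d - s.+1, k.-1)%:R * 'X^s :> {poly R}.
Proof.
case: k => // k _; elim: k => [|k IHk].
  rewrite big_ord1 bin0 !mul1r expr1.
  under eq_bigr do rewrite bin0 mul1r.
  by rewrite -subrX1 addrC subrK.
rewrite big_ord_recr {}IHk /= sum_bin_expX (exprS _ k.+1); ring.
Qed.
(** * Averages over the vertices of a box *)

(** List each set followed by its complement, and match equal positions in the two lists. *)
Lemma perm_imset_transitive (T : finType) (S S' : {set T}) :
  #|S| = #|S'| -> exists s : {perm T}, s @: S = S'.
Proof.
move=> eqSS'; pose e (A : {set T}) := enum A ++ enum (~: A).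
have mem_e A x : x \in e A by rewrite mem_cat !mem_enum inE orbN.
have uniq_e A : uniq (e A).
  rewrite cat_uniq !enum_uniq andbT /=; apply/hasPn => x.
  by rewrite !mem_enum inE.
have size_e A : size (e A) = #|T| by rewrite size_cat -!cardE cardsC.
pose f x := nth x (e S') (index x (e S)).
have ltf x : (index x (e S) < size (e S'))%N by rewrite size_e -(size_e S) index_mem.
have f_inj : injective f.
  move=> x y; rewrite /f (set_nth_default x) // => /eqP.
  rewrite nth_uniq // => /eqP eq_xy.
  by rewrite -(nth_index x (mem_e S x)) eq_xy nth_index.
exists (perm f_inj); apply/eqP.
rewrite eqEcard card_imset ?eqSS' ?leqnn ?andbT; last exact: perm_inj.
apply/subsetP => _ /imsetP [x xS ->]; rewrite permE /f.
have ltx : (index x (enum S) < #|S'|)%N by rewrite -eqSS' cardE index_mem mem_enum.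
by rewrite index_cat mem_enum xS nth_cat -cardE ltx -mem_enum mem_nth // -cardE.
Qed.

Definition last_ords (d i : nat) : {set 'I_d} := [set x : 'I_d | (i <= x)%N].

Lemma card_last_ords (d i : nat) : #|last_ords d i| = (d - i)%N.
Proof.
rewrite cardsE -sum1_card -(big_geq_mkord i d xpredT (fun=> 1%N)).
by rewrite big_const_nat iter_addn_0 mul1n.
Qed.

(* The average of F over the vertices with i upper coordinates, written as an
   average over permutations. *)
Definition average (R : realType) (d : nat) (F : vec R 'I_d -> R)
    (a b : vec R 'I_d) (i : nat) : R :=
  #|{perm 'I_d}|%:R^-1 * \sum_(s : {perm 'I_d}) F (vertex a b (s @: last_ords d i)).

(** Translation in the permutation group makes the average depend only on the cardinal of [S]. *)
Lemma average_card (R : realType) (d : nat) (F : vec R 'I_d -> R)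
    (a b : vec R 'I_d) (S : {set 'I_d}) :
  #|{perm 'I_d}|%:R^-1 * (\sum_(s : {perm 'I_d}) F (vertex a b (s @: S))) =
  average F a b (d - #|S|)%N.
Proof.
have le_Sd : (#|S| <= d)%N by rewrite -[X in (_ <= X)%N]card_ord max_card.
have [|t <-] := @perm_imset_transitive _ (last_ords d (d - #|S|)) S.
  by rewrite card_last_ords subKn.
rewrite card_imset ?card_last_ords ?subKn ?leq_subr //; last exact: perm_inj.
congr (_ * _); rewrite [RHS](reindex_inj (mulgI t)) /=; apply: eq_bigr => s _.
by rewrite -imset_comp; congr (F (vertex a b _)); apply: eq_imset => x; rewrite /= permM.
Qed.

(** The coordinates in [L] are pinned low and those in [A] are differenced. After averaging, a
    subset [S] of [A] contributes only through the [d - #|S| - #|L|] upper coordinates of its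
    vertex. *)
Lemma umbral_average (R : realType) (d : nat) (F : vec R 'I_d -> R)
    (a b : vec R 'I_d) (A L : {set 'I_d}) : [disjoint A & L] ->
  umbral (average F a b) ('X^(d - #|A| - #|L|) * ('X - 1) ^+ #|A|) =
  #|{perm 'I_d}|%:R^-1 *
    \sum_(s : {perm 'I_d}) face F a (vertex a b (s @: L)) (s @: A).
Proof.
move=> disjAL.
have cardAL : (#|A| + #|L| <= d)%N.
  by rewrite -[X in (_ <= X)%N]card_ord -cardsUI disjoint_setI0 // cards0 addn0 max_card.
have faceE (s : {perm 'I_d}) : face F a (vertex a b (s @: L)) (s @: A) =
    \sum_(S : {set 'I_d} | S \subset A) (-1) ^+ #|S| * F (vertex a b (s @: (S :|: L))).
  have s_inj : injective s := @perm_inj _ s.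
  rewrite /face (reindex_inj (imset_inj s_inj)) /=; apply: eq_big => S.
    apply/idP/idP => [/subsetP sSA|]; last exact: imsetS.
    by apply/subsetP => x xS; have := sSA (s x); rewrite !mem_imset //; apply.
  move=> _; rewrite card_imset // imsetU; congr (_ * F _).
  by apply/ffunP => x; rewrite !ffunE !inE; case: (x \in s @: S).
pose f l := (-1) ^+ l * average F a b (d - #|A| - #|L| + #|A| - l)%N.
rewrite umbral_diff -(sum_subsets A f) /f.
rewrite (eq_bigr _ (fun s _ => faceE s)) exchange_big mulr_sumr /=.
apply: eq_bigr => S sSA; rewrite -mulr_sumr [in RHS]mulrCA average_card.
congr (_ * average _ _ _ _); rewrite cardsU disjoint_setI0 ?cards0; last first.
  exact: disjointWl sSA disjAL.
have := subset_leq_card sSA.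
by move: (#|A|) (#|L|) (#|S|) cardAL => x y z; lia.
Qed.

Lemma umbral_average_ge0 (R : realType) (d : nat) (F : vec R 'I_d -> R)
    (a b : vec R 'I_d) (i j : nat) : (i + j <= d)%N ->
  (forall (A L : {set 'I_d}), #|A| = j -> #|L| = (d - i - j)%N ->
     0 <= face F a (vertex a b L) A) ->
  0 <= umbral (average F a b) ('X^i * ('X - 1) ^+ j).
Proof.
move=> le_ijd faceF; pose L := last_ords d (i + j); pose A := last_ords d i :\: L.
have cardL : #|L| = (d - i - j)%N by rewrite card_last_ords subnDA.
have cardA : #|A| = j.
  rewrite cardsD (setIidPr _) ?card_last_ords; first by lia.
  by apply/subsetP => x; rewrite !inE; lia.
have /(umbral_average F a b) : [disjoint A & L].
  by rewrite -setI_eq0; apply/eqP/setP => x; rewrite !inE; case: (i + j <= x)%N; rewrite ?andbF.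
rewrite cardA cardL (_ : d - j - (d - i - j) = i)%N ?umbral_average; last by lia.
move=> ->; rewrite mulr_ge0 ?invr_ge0 ?ler0n // sumr_ge0 // => s _.
by apply: faceF; rewrite card_imset //; apply: perm_inj.
Qed.

Lemma average_top (R : realType) (d : nat) (F : vec R 'I_d -> R) (a b : vec R 'I_d) :
  average F a b d = F b.
Proof.
rewrite -[in LHS](umbralXn (average F a b)).
have disj0 : [disjoint set0 & (set0 : {set 'I_d})] by rewrite -setI_eq0 set0I.
have := umbral_average F a b disj0; rewrite cards0 !subn0 mulr1 => ->.
under eq_bigr do rewrite !imset0 face0.
rewrite sumr_const -[X in _ * X]mulr_natl mulKf; last first.
  by rewrite pnatr_eq0 -lt0n; apply/card_gt0P; exists 1%g.
by congr F; apply/ffunP => x; rewrite ffunE inE.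
Qed.

Lemma umbral_average_volume (R : realType) (d : nat) (F : vec R 'I_d -> R)
    (a b : vec R 'I_d) :
  umbral (average F a b) (('X - 1) ^+ d) = volume F a b.
Proof.
have disjT0 : [disjoint setT & (set0 : {set 'I_d})] by rewrite -setI_eq0 setI0.
have := umbral_average F a b disjT0.
rewrite cards0 cardsT card_ord subnn mul1r => ->.
rewrite (eq_bigr (fun=> volume F a b)) => [|s _]; last first.
  rewrite imset0 -faceT; congr (face F a _ _).
    by apply/ffunP => x; rewrite ffunE inE.
  apply/eqP; rewrite eqEcard subsetT card_imset ?leqnn //; exact: perm_inj.
rewrite sumr_const -[X in _ * X]mulr_natl mulKf //.
by rewrite pnatr_eq0 -lt0n; apply/card_gt0P; exists 1%g.
Qed.

(** * The upper bound *)

Lemma volume_le (R : realType) (d k : nat) (Q : vec R 'I_d -> R)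
    (a b : vec R 'I_d) (M : R) :
  (2 <= k <= d)%N -> quasi_copula Q -> k_increasing k Q -> is_box a b -> 0 <= M ->
  (forall i, (k <= i <= d)%N -> mpv_term R d k i <= M) ->
  volume Q a b <= M.
Proof.
case/andP => k2 le_kd qcQ incQ box M0 leM.
set q := average Q a b.
have vertex_box L : is_box a (vertex a b L).
  case: box => a01 b01 le_ab; split=> // x; rewrite ffunE; case: ifP => // _.
have face_nonneg (A L : {set 'I_d}) : (#|A| <= k)%N -> 0 <= face Q a (vertex a b L) A.
  move=> leA; apply: face_ge0 (qc_grounded qcQ) incQ _ (vertex_box L).
  by rewrite leA card_ord.
pose w i := umbral q ('X^i * ('X - 1) ^+ k).
have w_ge0 i : (i + k <= d)%N -> 0 <= w i.
  by move=> le_ikd; apply: umbral_average_ge0 => // A L cardA _; rewrite face_nonneg ?cardA.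
have volE : volume Q a b = umbral w (('X - 1) ^+ (d - k)).
  by rewrite -umbral_average_volume -umbralM -exprD subnK.
(* The discarded Taylor terms of order below [k] are nonnegative. *)
have le_taylor : umbral w (\sum_(s < d) 'C(d - s.+1, k.-1)%:R * 'X^s) <= q d.
  rewrite -umbralM -[q d]umbralXn (expX_taylor _ d (ltnW k2)) mulrC linearD /= lerDr.
  rewrite linear_sum sumr_ge0 // => j _; rewrite mulr_natl linearMn mulrn_wge0 //=.
  have := @umbral_average_ge0 _ _ Q a b 0 j; rewrite mul1r; apply.
    by rewrite (leq_trans (ltnW (ltn_ord j))).
  by move=> A L cardA _; rewrite face_nonneg // cardA ltnW.
have qd : q d <= 1.
  by rewrite /q average_top; case: box => _ /(qc_range qcQ)/andP [].
apply: (@le_trans _ _ (M * q d)); last by rewrite ler_piMr.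
apply: le_trans (ler_wpM2l M0 le_taylor).
(* Beyond [d - k] the sign of [w s] is not known, but there the binomial vanishes. *)
have -> : umbral w (\sum_(s < d) 'C(d - s.+1, k.-1)%:R * 'X^s) =
    \sum_(s < (d - k).+1) 'C(d - s.+1, k.-1)%:R * w s.
  pose f s := 'C(d - s.+1, k.-1)%:R * w s.
  rewrite linear_sum /= (big_ord_widen d f) /f; last by lia.
  rewrite [RHS]big_mkcond /=; apply: eq_bigr => s _.
  rewrite mulr_natl linearMn /= umbralXn; case: ltnP => ge_s; first by rewrite mulr_natl.
  by rewrite bin_small ?mulr0n //; move: ge_s (ltn_ord s); lia.
have := umbral_diff w 0 (d - k); rewrite mul1r -volE => ->.
(* Reversing the sum aligns both sides on [w s]; the coefficient bound is then [leM] at [s + k],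
   multiplied by [gamma]. *)
rewrite (reindex_inj rev_ord_inj) mulr_sumr /=; apply: ler_sum => s _.
have le_s : (s <= d - k)%N by rewrite -ltnS.
rewrite subSS add0n subKn // bin_sub // !mulrA ler_wpM2r ?w_ge0 //; first by lia.
have /leM : (k <= s + k <= d)%N by lia.
rewrite /mpv_term addnK gammaE; [|lia|lia].
rewrite (_ : d - (s + k) + k.-1 = d - s.+1)%N; last by lia.
rewrite ler_pdivrMr ?ltr0n ?bin_gt0; last by lia.
by rewrite mulrC (_ : d - (s + k) = d - k - s)%N //; lia.
Qed.

(** * The extremal sequence *)

(** The shift [i0 - k.-1] makes the binomial 0 below [i0] and 1 at [i0], and puts the spike of the
    [k]-th difference at [i0 - k]. *)
Definition extremal_sequence (R : realType) (d k i0 i : nat) : R :=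
  shifted_bin R (i0 - k.-1) k.-1 i * (gamma d k i0)%:R^-1.

Lemma gamma_gt0 (d k i : nat) : (2 <= k <= i)%N -> (i <= d)%N -> (0 < gamma d k i)%N.
Proof. by move=> kli lid; rewrite gammaE // bin_gt0 leq_addl. Qed.

Lemma extremal_sequence_diff_top (R : realType) (d k i0 i : nat) :
  (2 <= k <= i0)%N ->
  umbral (extremal_sequence R d k i0) ('X^i * ('X - 1) ^+ k) =
  (i == i0 - k)%N%:R / (gamma d k i0)%:R.
Proof.
case: k => // k /andP [k2 le_ki0].
rewrite umbral_scale umbral_shifted_bin_top; congr (_%:R / _).
by rewrite (_ : i0 - k.+1.-1 = (i0 - k.+1).+1)%N //= subnSK.
Qed.

Lemma extremal_sequence_monotone (R : realType) (d k i0 : nat) :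
  (2 <= k <= i0)%N -> up_to_order_monotone (extremal_sequence R d k i0) k 1.
Proof.
move=> kli i j le_jk; rewrite mul1r.
have [->|neq_jk] := eqVneq j k.
  by rewrite extremal_sequence_diff_top // divr_ge0 ?ler0n.
rewrite umbral_scale umbral_shifted_bin ?divr_ge0 ?ler0n //; lia.
Qed.

Lemma extremal_sequence_last (R : realType) (d k i0 : nat) :
  (2 <= k <= i0)%N -> (i0 <= d)%N -> extremal_sequence R d k i0 d = 1.
Proof.
move=> kli lid; rewrite /extremal_sequence /shifted_bin ifT; last by lia.
rewrite gammaE // (_ : d - (i0 - k.-1) = d - i0 + k.-1)%N; last by lia.
by rewrite divff // pnatr_eq0 -lt0n bin_gt0 leq_addl.
Qed.

(** Pascal's rule: after multiplication by [gamma], the value at [d.-1] is [gamma - alpha]. *)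
Lemma extremal_sequence_penultimate (R : realType) (d k i0 : nat) :
  (2 <= k <= i0)%N -> (i0 <= d)%N ->
  extremal_sequence R d k i0 d.-1 = 1 - (alpha d k i0)%:R / (gamma d k i0)%:R.
Proof.
move=> kli lid.
have g_neq0 : (gamma d k i0)%:R != 0 :> R by rewrite pnatr_eq0 -lt0n gamma_gt0.
apply: (mulIf g_neq0); rewrite mulrBl mul1r !divfK //.
rewrite /shifted_bin ifT; last by lia.
rewrite gammaE // alphaE //; apply/eqP; rewrite eq_sym subr_eq -natrD eqr_nat.
case: k kli {g_neq0} => [|[|k]] // kli.
by rewrite /= addnS binS eqn_add2r; apply/eqP; congr 'C(_, _); lia.
Qed.

(** The recursion says that the [k]-th difference vanishes at [i - k] for [i > i0], as it does for
    the extremal sequence away from its spike. *)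
Lemma extremal_sequence_unique (R : realType) (d k i0 : nat) (q : nat -> R) :
  (2 <= k <= i0)%N -> (i0 <= d)%N ->
  (forall i, (i < i0)%N -> q i = 0) ->
  q i0 = (gamma d k i0)%:R^-1 ->
  (forall i, (i0 < i <= d)%N ->
     q i = \sum_(1 <= j < k.+1) 'C(k, j)%:R * (-1) ^+ (j + 1) * q (i - j)%N) ->
  forall i, (i <= d)%N -> q i = extremal_sequence R d k i0 i.
Proof.
move=> kli lid q_small q_i0 q_rec; elim/ltn_ind => i IHi le_id.
have [lt_i|gt_i|eq_i] := ltngtP i i0.
- rewrite q_small // /extremal_sequence /shifted_bin.
  by case: ifP => _; rewrite ?bin_small ?mul0r //; lia.
- rewrite q_rec ?gt_i //.
  have := extremal_sequence_diff_top R d (i - k) kli.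
  rewrite (_ : (i - k == i0 - k)%N = false) ?mul0r; last by lia.
  rewrite umbral_diff big_ord_recl /= bin0 !mul1r subn0 subnK; last by lia.
  move/eqP; rewrite addr_eq0 => /eqP ->; rewrite -sumrN big_add1 big_mkord /=.
  apply: eq_bigr => j _; rewrite /bump /= add1n addn1 IHi; [|lia|lia].
  by rewrite !exprS; ring.
- rewrite eq_i q_i0 /extremal_sequence /shifted_bin leq_subr subKn; last by lia.
  by rewrite binn mul1r.
Qed.

Lemma volume_symmetric (R : realType) (d : nat) (Q : vec R 'I_d -> R)
    (a : R) (q : nat -> R) : a != 1 ->
  (forall z : vec R 'I_d, (forall j, z j = a \/ z j = 1) ->
     Q z = q (d - #|[set j : 'I_d | z j == a]|)%N) ->
  volume Q (cvec a) (cvec 1) = umbral q (('X - 1) ^+ d).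
Proof.
move=> a1 Qz; have := umbral_diff q 0 d; rewrite mul1r add0n => ->.
have := sum_subsets [set: 'I_d] (fun l => (-1) ^+ l * q (d - l)%N).
rewrite cardsT card_ord => <-; rewrite -faceT; apply: eq_bigr => S _.
congr (_ * _); rewrite Qz => [|j]; last by rewrite !ffunE; case: ifP; [left|right].
congr (q (d - #|pred_of_set _|)%N); apply/setP => j; rewrite !inE !ffunE.
by case: ifP => jS; rewrite ?eqxx // eq_sym (negbTE a1).
Qed.

(** The [k]-th differences form a spike at [i0 - k], so only the term [l = d - i0] of the remaining
    [d - k] differences survives. *)
Lemma extremal_volume (R : realType) (d k i0 : nat) :
  (2 <= k <= i0)%N -> (i0 <= d)%N ->
  umbral (extremal_sequence R d k i0) (('X - 1) ^+ d) = mpv_term R d k i0.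
Proof.
move=> kli lid.
have -> : ('X - 1) ^+ d = ('X - 1) ^+ (d - k) * ('X - 1) ^+ k :> {poly R}.
  by rewrite -exprD subnK //; lia.
rewrite umbralM -[_ ^+ (d - k)]mul1r -[1 * _]/('X^0 * _) umbral_diff.
have lt_l : (d - i0 < (d - k).+1)%N by lia.
rewrite (bigD1 (Ordinal lt_l)) //= big1 ?addr0 => [|l /eqP neq_l].
  rewrite extremal_sequence_diff_top //.
  rewrite (_ : 0 + (d - k) - (d - i0) = i0 - k)%N ?eqxx; last by lia.
  rewrite /mpv_term (_ : d - i0 = d - k - (i0 - k))%N ?bin_sub; [|lia|lia].
  by rewrite mul1r mulrA [_ * (-1) ^+ _]mulrC.
rewrite extremal_sequence_diff_top // (_ : (_ == _) = false) ?mul0r ?mulr0 //.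
apply/negbTE/eqP => eq_l; apply: neq_l; apply/val_inj => /=.
by have := ltn_ord l; lia.
Qed.

Lemma extremal_quasi_copula (R : realType) (d k i0 : nat) :
  (2 <= k <= i0)%N -> (i0 <= d)%N ->
  let a : R := 1 - (alpha d k i0)%:R / (gamma d k i0)%:R in
  is_box (cvec a : vec R 'I_d) (cvec 1) /\
  exists Q : vec R 'I_d -> R,
    [/\ quasi_copula Q, k_increasing k Q,
      forall z : vec R 'I_d, (forall j, z j = a \/ z j = 1) ->
        Q z = extremal_sequence R d k i0 (d - #|[set j : 'I_d | z j == a]|)%N
      & volume Q (cvec a) (cvec 1) = mpv_term R d k i0].
Proof.
move=> kli lid a.
have aE : a = extremal_sequence R d k i0 d.-1 by rewrite extremal_sequence_penultimate.
have a1 : a < 1.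
  rewrite /a ltrBlDr ltrDl divr_gt0 // ltr0n ?gamma_gt0 // alphaE //.
  by rewrite bin_gt0 leq_addl.
(* As a value of the extremal sequence, [a] is a difference of order 0. *)
have a0 : 0 <= a.
  have := extremal_sequence_monotone R d kli d.-1 (leq0n k).
  by rewrite mul1r mulr1 umbralXn -aE.
split; first by split=> j; rewrite !ffunE ?ler01 ?lexx ?a0 ?ltW.
have [||||Q [qcQ incQ Qz]] := @interpolation R d k (extremal_sequence R d k i0).
- by lia.
- exact: extremal_sequence_monotone.
- exact: extremal_sequence_last.
- by rewrite -aE.
rewrite -aE in Qz; exists Q; split=> //.
by rewrite (volume_symmetric _ Qz) ?lt_eqF // extremal_volume.
Qed.

(* The big maximum starts from its own term of index d, so it is the maximum
   of the terms of index k, ..., d. *)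
Theorem theorem2 (R : realType) (d k : nat) (hk : (2 <= k)%N) (hkd : (k <= d)%N) :
  [/\ is_maximum (volumes R d k) (MPV R d k),
      MPV R d k =
        \big[Num.max/mpv_term R d k d]_(k <= i < d.+1) mpv_term R d k i
    & forall i0 : nat, (k <= i0 <= d)%N ->
        MPV R d k = mpv_term R d k i0 ->
        let a : R := 1 - (alpha d k i0)%:R / (gamma d k i0)%:R in
        forall q : nat -> R,
          (forall i, (i < i0)%N -> q i = 0) ->
          q i0 = (gamma d k i0)%:R^-1 ->
          (forall i, (i0 < i <= d)%N ->
             q i = \sum_(1 <= j < k.+1)
                     'C(k, j)%:R * (-1) ^+ (j + 1) * q (i - j)%N) ->
          is_box (cvec a : vec R 'I_d) (cvec 1) /\
          exists Q : vec R 'I_d -> R,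
            [/\ quasi_copula Q,
                k_increasing k Q,
                forall z : vec R 'I_d, (forall j, z j = a \/ z j = 1) ->
                  Q z = q (d - #|[set j : 'I_d | z j == a]|)%N
              & volume Q (cvec a) (cvec 1) = MPV R d k]].
Proof.
set M := \big[_/_]_(_ <= _ < _) _.
have leM i : (k <= i <= d)%N -> mpv_term R d k i <= M.
  by move=> kid; apply: le_bigmax_seq; rewrite ?mem_index_iota.
have [i1 ki1d M_eq] : exists2 i1, (k <= i1 <= d)%N & M = mpv_term R d k i1.
  rewrite /M big_seq; elim/big_rec: _ => [|i m]; first by exists d; rewrite ?hkd ?leqnn.
  rewrite mem_index_iota ltnS => kid [j kjd ->].
  by rewrite /Num.max; case: ifP => _; [exists j | exists i].
(* The term of index [d] has sign +1. *)
have M0 : 0 <= M.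
  apply: le_trans (leM d _); last by rewrite hkd leqnn.
  by rewrite /mpv_term subnn mul1r mulr_ge0 ?invr_ge0 ?ler0n.
have ubM : ubound (volumes R d k) M.
  by move=> v [Q [a [b [qcQ incQ box ->]]]]; apply: volume_le box M0 leM => //; rewrite hk.
have kl i : (k <= i <= d)%N -> (2 <= k <= i)%N /\ (i <= d)%N by lia.
have volM : volumes R d k M.
  have [kli lid] := kl _ ki1d.
  have [box [Q [qcQ incQ _ volQ]]] := extremal_quasi_copula R kli lid.
  exists Q, (cvec (1 - (alpha d k i1)%:R / (gamma d k i1)%:R)), (cvec 1).
  by rewrite volQ.
have supM : MPV R d k = M.
  apply/eqP; rewrite eq_le /MPV ge_sup //=; last by exists M.
  by rewrite ub_le_sup //; exists M.
rewrite supM; split=> // i0 /kl [kli lid] Mi0 a q q_small q_i0 q_rec.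
have [box [Q [qcQ incQ Qz volQ]]] := extremal_quasi_copula R kli lid.
split=> //; exists Q; split=> // [z zE|]; last by rewrite Mi0.
by rewrite Qz // -(extremal_sequence_unique kli lid q_small q_i0 q_rec) // leq_subr.
Qed.
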